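(* For every instance $(\mathcal F,\mathcal C,d,c,k)$ of the uncapacitated robust facility location problem, a static assignment policy is optimal for the linear relaxation (LP-URFL). That is, there exist an optimal solution $\big((x_i)_{i\in\mathcal F},(y^S_{ij})_{S\in\mathcal C^k,\,i\in\mathcal F,\,j\in S}\big)$ of (LP-URFL) and numbers $y_{ij}\ge 0$ ($i\in\mathcal F$, $j\in\mathcal C$) such that $y^S_{ij}=y_{ij}$ for all $S\in\mathcal C^k$, $i\in\mathcal F$, $j\in S$.
   Context: An instance consists of a nonempty finite set $\mathcal F$ of $n$ facilities and a finite set $\mathcal C$ of $m$ clients in a common metric space with distance $d$ ($d_{ij}$ is the distance between $i$ and $j$), a cost $c_i\ge 0$ for each $i\in\mathcal F$ (the cost of opening facility $i$ with unlimited supply), and an integer $k\ge 1$. The set of scenarios $\mathcal C^k$ is the family of all subsets of $\mathcal C$ of size at most $k$. The uncapacitated robust facility location problem (URFL) is $$\min\ \sum_{i\in\mathcal F}c_ix_i+\max_{S\in\mathcal C^k}\sum_{i\in\mathcal F}\sum_{j\in S}d_{ij}y^S_{ij}$$ subject to $\sum_{i\in\mathcal F}y^S_{ij}\ge 1$ for all $S\in\mathcal C^k$, $j\in S$; $x_i\ge y^S_{ij}$ for all $i\in\mathcal F$, $S\in\mathcal C^k$, $j\in S$; $x_i\in\{0,1\}$ and $y^S_{ij}\ge 0$ for all $i\in\mathcal F$, $S\in\mathcal C^k$, $j\in S$. Its linear relaxation (LP-URFL) is obtained by replacing $x_i\in\{0,1\}$ with $x_i\ge 0$ for every $i\in\mathcal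 F$. A static assignment policy is a choice of second-stage variables that do not depend on the scenario: there are $y_{ij}\ge 0$ for $i\in\mathcal F$, $j\in\mathcal C$ with $y^S_{ij}=y_{ij}$ for all $S\in\mathcal C^k$, $i\in\mathcal F$, $j\in S$. *)

(* Defs.v *)
From HB Require Import structures.
From mathcomp Require Import all_boot all_order all_algebra.
From mathcomp Require Import reals topology.

Set Implicit Arguments.
Unset Strict Implicit.
Unset Printing Implicit Defensive.

Import Order.TTheory GRing.Theory Num.Theory.

Local Open Scope ring_scope.

Definition scenarios (C : finType) (k : nat) : {set {set C}} :=
  [set S : {set C} | (#|S| <= k)%N].

Section URFL.
Context {R : realType} {F C : finType}.
Implicit Types (d : F -> C -> R) (c x : F -> R) (k : nat).

(* The second-stage variable y^S_ij is [y S i j]. It exists only for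
   [S \in scenarios C k] and [j \in S]: the values of [y] elsewhere are junk,
   and no definition below depends on them. *)
Implicit Types (y : {set C} -> F -> C -> R).

Definition assignment_cost d y (S : {set C}) : R :=
  \sum_(i : F) \sum_(j in S) d i j * y S i j.

(* The empty set is a scenario for every [k], so starting the iterated maximum
   from its cost gives exactly the maximum over the scenarios. *)
Definition worst_case_cost d k y : R :=
  \big[Num.max/assignment_cost d y set0]_(S in scenarios C k)
    assignment_cost d y S.

Definition objective d c k x y : R :=
  \sum_(i : F) c i * x i + worst_case_cost d k y.

Definition lp_feasible k x y : Prop :=
  [/\ forall S j, S \in scenarios C k -> j \in S -> 1 <= \sum_(i : F) y S i j,
      forall S i j, S \in scenarios C k -> j \in S -> y S i j <= x i,
      forall i, 0 <= x i
    & forall S i j, S \in scenarios C k -> j \in S -> 0 <= y S i j].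

Definition lp_optimal d c k x y : Prop :=
  lp_feasible k x y /\
  forall x' y', lp_feasible k x' y' ->
    objective d c k x y <= objective d c k x' y'.

Definition static_policy k y : Prop :=
  exists y0 : F -> C -> R,
    (forall i j, 0 <= y0 i j) /\
    forall S i j, S \in scenarios C k -> j \in S -> y S i j = y0 i j.

End URFL.

(* Main.v *)
(** In any feasible solution the assignments of the pairs (S, j) do not interact
    once x is fixed, so every client j may use, in all scenarios, the cheapest of
    its assignments y^S_{.j}: this yields a static solution costing no more in
    each scenario.  Since costs and distances are nonnegative, static solutions
    may further be truncated to [0, 1], where they form a compact set on which
    the objective, being continuous, attains its minimum. *)
Require Import Defs.
From mathcomp Require Import all_boot all_order all_algebra.
From mathcomp Require Import boolp classical_sets reals topology normedtype derive.

Import Order.TTheory GRing.Theory Num.Theory.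
Import numFieldNormedType.Exports.

Local Open Scope ring_scope.

(** If some term reaches 1, its truncation equals 1 and suffices alone, the others being
    nonnegative; otherwise truncation changes no term. *)
Lemma ge1_sum_min1 (R : realDomainType) (I : finType) (f : I -> R) :
  (forall i, 0 <= f i) -> 1 <= \sum_i f i -> 1 <= \sum_i Num.min (f i) 1.
Proof.
move=> f_ge0 sum_ge1; have [/existsP[i0 f_ge1]|] := boolP [exists i, 1 <= f i].
  rewrite (bigD1 i0) //= (min_idPr f_ge1) lerDl sumr_ge0 // => i _.
  by rewrite le_min f_ge0 ler01.
rewrite negb_exists => /forallP f_lt1; rewrite (eq_bigr f) // => i _.
by apply/min_idPl; rewrite ltW // ltNge.
Qed.

Section StaticPolicies.
Context {R : realType} {F C : finType}.
Implicit Types (d : F -> C -> R) (c x : F -> R) (k : nat).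
Implicit Types (y : {set C} -> F -> C -> R) (s : F -> C -> R).

(** The constraints on a static [s] are the same in every scenario, so neither [k] nor [S] appears.
    The upper bounds 1 are added to the LP constraints to make the set bounded. *)
Definition static_feasible x s : Prop :=
  [/\ forall j, 1 <= \sum_i s i j,
      forall i j, s i j <= x i,
      forall i, 0 <= x i <= 1
    & forall i j, 0 <= s i j <= 1].

Lemma static_feasible_lp k x s :
  static_feasible x s -> lp_feasible k x (fun=> s).
Proof.
by case=> sum_ge1 le_x x01 y01; split=> // [i|S i j _ _];
  [case/andP: (x01 i) | case/andP: (y01 i j)].
Qed.

Lemma le_worst_case_cost d k y y' :
  (forall S, S \in scenarios C k ->
    assignment_cost d y S <= assignment_cost d y' S) ->
  worst_case_cost d k y <= worst_case_cost d k y'.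
Proof.
move=> le_cost; apply: (big_ind2 (fun a b : R => a <= b)) => //.
(* The starting value of the maximum is the cost of the empty set, itself a scenario. *)
- by apply: le_cost; rewrite inE cards0.
- by move=> a1 a2 b1 b2 le_a le_b; rewrite ge_max !le_max le_a le_b orbT.
Qed.

Lemma static_feasible_dominates {d c k x y} :
    (forall i j, 0 <= d i j) -> (forall i, 0 <= c i) -> (1 <= k)%N ->
    lp_feasible k x y ->
  exists x' s, static_feasible x' s /\
    objective d c k x' (fun=> s) <= objective d c k x y.
Proof.
move=> d_ge0 c_ge0 k_ge1 [sum_ge1 le_x x_ge0 y_ge0].
pose allowed j := [pred S : {set C} | (S \in scenarios C k) && (j \in S)].
(* Since [k] is at least 1, the singleton of [j] is a scenario, so the minimum defining [best j]
   ranges over a nonempty family. *)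
have allowed1 j : allowed j [set j] by rewrite /= !inE cards1 k_ge1 eqxx.
pose cost j S := \sum_i d i j * y S i j.
pose best j := [arg min_(S < [set j] | allowed j S) cost j S]%O.
have bestP j : [/\ best j \in scenarios C k, j \in best j &
    forall S, S \in scenarios C k -> j \in S -> cost j (best j) <= cost j S].
  rewrite /best; case: arg_minP => // S /andP[Sk jS] minS; split=> // T Tk jT.
  by apply: minS; rewrite /= Tk.
pose s i j := Num.min (y (best j) i j) 1.
(* Truncating [x] and [s] at the same level 1 preserves [s i j <= x i]. *)
exists (fun i => Num.min (x i) 1), s; split.
  split=> [j|i j|i|i j]; last 3 first.
  - have [bk jb _] := bestP j.
    by rewrite le_min !ge_min lexx orbT (le_x _ _ _ bk jb).
  - by rewrite le_min x_ge0 ler01 ge_min lexx orbT.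
  - by have [bk jb _] := bestP j; rewrite le_min y_ge0 // ler01 ge_min lexx orbT.
  - have [bk jb _] := bestP j.
    by apply: ge1_sum_min1 => [i|]; [exact: y_ge0 | exact: sum_ge1].
apply: lerD.
  by apply: ler_sum => i _; rewrite ler_wpM2l // ge_min lexx.
apply: le_worst_case_cost => S Sk; rewrite /assignment_cost.
(* With the client sum outside, the cost of [S] is the sum of [cost j S] over [j] in [S], and the
   choice of [best j] bounds each term separately. *)
rewrite exchange_big [leRHS]exchange_big /=; apply: ler_sum => j jS.
have [_ _ minb] := bestP j; apply: le_trans (minb S Sk jS).
by apply: ler_sum => i _; rewrite ler_wpM2l // ge_min lexx.
Qed.

Local Open Scope classical_set_scope.

(* x and the static y_ij are packed into one point of a power of R, so that
   Tychonoff's theorem applies to the pair. *)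
Local Notation point :=
  (prod_topology (fun _ : F * option C => R : topologicalType)).
Local Notation xpart := (fun (z : point) i => z (i, None)).
Local Notation ypart := (fun (z : point) i j => z (i, Some j)).

Lemma continuous_sum (T : topologicalType) (I : Type) (r : seq I) (P : pred I)
    (f : I -> T -> R) :
  (forall i, P i -> continuous (f i)) ->
  continuous (fun t => \sum_(i <- r | P i) f i t).
Proof. by apply: continuous_big; exact: add_continuous. Qed.

Lemma continuous_bigmax (T : topologicalType) (I : Type) (r : seq I)
    (P : pred I) (f0 : T -> R) (f : I -> T -> R) :
  continuous f0 -> (forall i, P i -> continuous (f i)) ->
  continuous (fun t => \big[Num.max/f0 t]_(i <- r | P i) f i t).
Proof.
move=> f0_cont f_cont; elim: r => [|i r IHr].
  by rewrite [X in continuous X](_ : _ = f0) //; apply/funext=> t; rewrite big_nil.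
have [Pi|nPi] := boolP (P i).
  rewrite [X in continuous X](_ : _ = f i \max
      (fun t => \big[Num.max/f0 t]_(i <- r | P i) f i t)).
    by move=> t; apply: continuous_max; [exact: f_cont | exact: IHr].
  by apply/funext=> t; rewrite big_cons Pi.
rewrite [X in continuous X](_ : _ =
    fun t => \big[Num.max/f0 t]_(i <- r | P i) f i t) //.
by apply/funext=> t; rewrite big_cons (negbTE nPi).
Qed.

Lemma continuous_coord p : continuous (fun z : point => z p).
Proof. exact: proj_continuous. Qed.

Lemma continuous_scaled_coord a p : continuous (fun z : point => a * z p).
Proof.
move=> z; apply: (@continuous_comp point R R (fun z' => z' p) ( *%R a)).
  exact: continuous_coord.
exact: mulrl_continuous.
Qed.

Lemma continuous_assignment_cost d S :
  continuous (fun z : point => assignment_cost d (fun=> ypart z) S).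
Proof.
apply: continuous_sum => i _; apply: continuous_sum => j _.
exact: continuous_scaled_coord.
Qed.

Lemma continuous_objective d c k :
  continuous (fun z : point => objective d c k (xpart z) (fun=> ypart z)).
Proof.
have opening_cont : continuous (fun z : point => \sum_i c i * xpart z i).
  by apply: continuous_sum => i _; exact: continuous_scaled_coord.
have assignment_cont :
    continuous (fun z : point => worst_case_cost d k (fun=> ypart z)).
  by apply: continuous_bigmax => [|S _]; exact: continuous_assignment_cost.
by move=> z; exact: cvgD (opening_cont z) (assignment_cont z).
Qed.

Lemma compact_static_feasible :
  compact [set z : point | static_feasible (xpart z) (ypart z)].
Proof.
have cube_compact :
    compact [set z : point | forall p, `[0, 1]%classic (z p)].
  apply: (@tychonoff (F * option C)%type (fun=> R)
    (fun=> `[0, 1]%classic)) => p.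
  exact: segment_compact.
(* The bounds cut out the compact cube; each remaining constraint is the preimage of a closed
   half-line under a continuous map, [s i j <= x i] being rewritten as a difference for this
   purpose. *)
have -> : [set z : point | static_feasible (xpart z) (ypart z)] =
    [set z : point | forall p, `[0, 1]%classic (z p)] `&`
    ((\bigcap_(j in [set: C]) [set z : point | 1 <= \sum_i z (i, Some j)]) `&`
    (\bigcap_(p in [set: F * C])
       [set z : point | 0 <= z (p.1, None) - z (p.1, Some p.2)])).
  apply/seteqP; split=> z /=.
    case=> sum_ge1 le_x x01 y01; split.
      by case=> i [j|] /=; rewrite in_itv /=.
    by split=> [j _|[i j] _] //=; rewrite subr_ge0.
  case=> z01 [sum_ge1 le_x]; split=> [j|i j|i|i j].
  - exact: sum_ge1.
  - by have := le_x (i, j) I; rewrite /= subr_ge0.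
  - by have := z01 (i, None); rewrite /= in_itv.
  - by have := z01 (i, Some j); rewrite /= in_itv.
apply: compact_closedI cube_compact _.
apply: closedI; apply: closed_bigI.
  move=> j _; apply: (@preimage_closed _ R
    (fun z : point => \sum_i z (i, Some j)) [set r | 1 <= r]).
    by move=> z _; apply: continuous_sum => i _; exact: continuous_coord.
  exact: closed_ge.
case=> i j _; apply: (@preimage_closed _ R
  (fun z : point => z (i, None) - z (i, Some j)) [set r | 0 <= r]).
  move=> z _; exact: cvgB (continuous_coord (i, None) z)
    (continuous_coord (i, Some j) z).
exact: closed_ge.
Qed.

Lemma static_minimizer d c k : (0 < #|F|)%N ->
  exists x s, static_feasible x s /\
    forall x' s', static_feasible x' s' ->
      objective d c k x (fun=> s) <= objective d c k x' (fun=> s').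
Proof.
move=> F_gt0.
have nonempty : [set z : point | static_feasible (xpart z) (ypart z)] !=set0.
  (* At the all-ones point each covering sum equals [#|F|], which is at least 1. *)
  exists (fun=> 1); split=> // [j|i|i j]; rewrite ?ler01 ?lexx //.
  by rewrite sumr_const ler1n.
have [z] := compact_EVT_min nonempty compact_static_feasible
  (continuous_subspaceT (continuous_objective d c k)).
rewrite inE => z_feas z_min; exists (xpart z), (ypart z); split=> // x s feas.
pose z' : point := fun p => if p.2 is Some j then s p.1 j else x p.1.
by apply: (z_min z'); rewrite inE.
Qed.

End StaticPolicies.

Theorem theorem1 (R : realType) (M : metricType R) (F C : finType)
    (facility : F -> M) (client : C -> M) (c : F -> R) (k : nat)
    (F_nonempty : (0 < #|F|)%N) (c_ge0 : forall i : F, 0 <= c i)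
    (k_ge1 : (1 <= k)%N) :
  exists (x : F -> R) (y : {set C} -> F -> C -> R),
    lp_optimal (fun i j => mdist (facility i) (client j)) c k x y /\
    static_policy k y.
Proof.
pose d i j := mdist (facility i) (client j).
have d_ge0 i j : 0 <= d i j by exact: mdist_ge0.
have [x [s [feas minz]]] := static_minimizer d c k F_nonempty.
exists x, (fun=> s); split; last first.
  by exists s; split=> // i j; have [_ _ _ /(_ i j)/andP[]] := feas.
(* An arbitrary LP solution costs at least as much as some truncated static one, hence at least as
   much as the static minimizer. *)
split=> [|x' y' /(static_feasible_dominates d_ge0 c_ge0 k_ge1)].
  exact: static_feasible_lp.
by case=> x'' [s' [/minz le1 le2]]; exact: le_trans le1 le2.
Qed.
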